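(* Let $r,p\ge 2$ be integers. Let $\mathcal{H}$ be a connected linear $r$-uniform hypergraph whose edges are colored with colors $1$ and $2$ such that there is at least one edge of each color. For $i\in\{1,2\}$, let $\mathcal{H}_i$ denote the subhypergraph of $\mathcal{H}$ (with vertex set $\mathcal{V}(\mathcal{H})$) consisting of the edges of color $i$. Suppose that the average degree of $\mathcal{H}_1$ satisfies $d(\mathcal{H}_1)\ge r(r-1)(p-1)+2r$. Then there exists in $\mathcal{H}$ a linear path of length at least $p$ such that its first edge has color $2$ and all its other edges have color $1$.
   Context: Hypergraphs are finite and simple. A hypergraph is linear if any two distinct edges share at most one vertex. A hypergraph is connected if its shadow (the graph on the same vertex set whose edges are all pairs of vertices contained in a common hyperedge) is connected. $d(\cdot)$ denotes average degree, so $d(\mathcal{H}_1)=r|\mathcal{E}(\mathcal{H}_1)|/|\mathcal{V}(\mathcal{H})|$. A linear path of length $\ell$ is a hypergraph with edges $e_1,\dots,e_\ell$ (in this order) such that $|e_i\cap e_{i+1}|=1$ for $1\le i\le \ell-1$ and $e_i\cap e_j=\emptyset$ for all other pairs $i\ne j$. *)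

(* Defs.v *)
From mathcomp Require Import all_boot all_order all_algebra.

Set Implicit Arguments.
Unset Strict Implicit.
Unset Printing Implicit Defensive.

(* A finite simple hypergraph with vertex set V (a finType) is given by its
   set of edges E : {set {set V}}.  A subhypergraph on the same vertex set is
   a subset of E over the same V, so isolated vertices count in avg_degree. *)
Section Hypergraph.
Variables (V : finType) (E : {set {set V}}).

Definition uniform (r : nat) : Prop := {in E, forall e : {set V}, #|e| = r}.

Definition linear_hypergraph : Prop :=
  {in E &, forall e f : {set V}, e != f -> #|e :&: f| <= 1}.

Definition shadow : rel V :=
  fun x y => (x != y) && [exists e in E, (x \in e) && (y \in e)].

Definition connected_hypergraph : Prop := forall x y, connect shadow x y.

Definition degree (v : V) : nat := #|[set e in E | v \in e]|.

Definition avg_degree : rat :=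
  ((\sum_v degree v)%N%:R / #|V|%:R)%R.

Lemma avg_degree_uniform (r : nat) :
  uniform r -> avg_degree = ((r * #|E|)%N%:R / #|V|%:R)%R.
Proof.
move=> Er; rewrite /avg_degree; congr (_%:R / _)%R.
under eq_bigr => v _ do rewrite /degree -sum1_card.
rewrite (exchange_big_dep (mem E)) /=; last by move=> v e _; rewrite inE => /andP[].
rewrite mulnC -sum_nat_const; apply: eq_bigr => e eE.
rewrite -(Er e eE) -sum1_card; apply: eq_bigl => v.
by rewrite inE eE.
Qed.

End Hypergraph.

Definition color_class (V : finType) (E : {set {set V}})
    (c : {set V} -> nat) (i : nat) : {set {set V}} :=
  [set e in E | c e == i].

(* s lists the edges in order; the length of the path is size s. *)
Definition linear_path (V : finType) (s : seq {set V}) : Prop :=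
  (forall i, i.+1 < size s -> #|nth set0 s i :&: nth set0 s i.+1| = 1) /\
  (forall i j, i.+1 < j -> j < size s -> nth set0 s i :&: nth set0 s j = set0).

(* Main.v *)
Require Import Defs.
From mathcomp Require Import all_boot all_order all_algebra.
From mathcomp Require Import zify.

(** The density of colour 1 gives more than [(r - 1) * (p - 1) + 1] edges of
    colour 1 per vertex, so deleting vertices of small degree leaves a nonempty
    vertex set [W], the core, in which every vertex lies on that many edges of
    colour 1 contained in [W] ([dense_core]).

    Grow linear paths from an edge of colour 2 by edges of colour 1, remembering
    an end vertex [x] of the last edge that lies on no earlier edge ([grown]).
    The set of possible end vertices is closed under adjacency: an edge of
    colour 2 starts a new path, and an edge of colour 1 that meets a grown path
    can be attached to the first edge of the path that it meets, the rest of
    the path being discarded ([grown_reroute]).  As the hypergraph is connected,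
    some grown path ends in [W].

    From there the path is extended greedily inside [W].  A path with [m] edges
    covers at most [(r - 1) * m + 1] vertices, one of which is its end [x]; by
    linearity each of the others spoils at most one edge through [x], so while
    [m < p] some edge of the core through [x] meets the path in [x] only
    ([escaping_edge], [grown_extend]).  The edges leading to [W] count towards
    both [m] and the length, so they need no separate treatment. *)

Set Implicit Arguments.
Unset Strict Implicit.
Unset Printing Implicit Defensive.

(** * Edges through a vertex *)

Lemma linear_meet_eq (V : finType) (E : {set {set V}}) (e f : {set V}) x y :
  linear_hypergraph E -> e \in E -> f \in E -> e != f ->
  x \in e -> x \in f -> y \in e -> y \in f -> x = y.
Proof.
move=> Elin eE fE ef xe xf ye yf.
by apply: (card_le1_eqP (Elin e f eE fE ef)); rewrite inE ?xe ?xf ?ye ?yf.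
Qed.

(** In a minimal nonempty [W] with at least [D] edges per vertex, deleting a
    vertex of degree less than [D] would keep that density; the set that
    remains is nonempty because an edge survives in it. *)
Lemma dense_core (V : finType) (F : {set {set V}}) (D : nat) :
  set0 \notin F -> 0 < #|V| -> D * #|V| <= #|F| ->
  exists2 W : {set V}, W != set0 &
    {in W, forall v, D <= degree [set e in F | e \subset W] v}.
Proof.
move=> F0 V0 hD.
pose P (W : {set V}) :=
  (W != set0) && (D * #|W| <= #|[set e in F | e \subset W]|).
have PT : P setT.
  rewrite /P -card_gt0 cardsT V0 /=; apply: leq_trans hD (subset_leq_card _).
  by apply/subsetP => e eF; rewrite inE eF subsetT.
case: (arg_minnP (fun W : {set V} => #|W|) PT) => W /andP[W0 WD] Wmin.
exists W => // v vW; rewrite leqNgt; apply/negP => small.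
have cW : #|W| = #|W :\ v|.+1 by rewrite (cardsD1 v W) vW.
set FW := [set e in F | e \subset W] in WD small.
have split_edges : #|FW| <=
    degree FW v + #|[set e in F | e \subset W :\ v]|.
  apply: leq_trans (leq_card_setU _ _); apply: subset_leq_card.
  apply/subsetP => e; rewrite !inE => /andP[eF eW]; rewrite eF eW subsetD1 eW.
  by case: (v \in e).
have : P (W :\ v).
  rewrite /P; apply/andP; split; last by nia.
  apply/eqP => Wv; move: split_edges; rewrite Wv.
  have -> : [set e in F | e \subset set0] = set0.
    apply/setP => e; rewrite !inE subset0; apply/negbTE/negP => /andP[eF /eqP e0].
    by move: F0; rewrite -e0 eF.
  by rewrite cards0; nia.
by move/Wmin; rewrite cW ltnn.
Qed.

(** Choosing for each edge through [v] a further vertex of [U] on it is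
    injective, as two edges through [v] share no other vertex. *)
Lemma escaping_edge (V : finType) (E N : {set {set V}}) (U : {set V}) v :
  linear_hypergraph E -> N \subset E -> v \in U -> #|U| <= degree N v ->
  exists f, [/\ f \in N, v \in f & f :&: U = [set v]].
Proof.
move=> Elin /subsetP NE vU hN.
have [/existsP[f /and3P[fN vf /eqP fU]]|none] :=
  boolP [exists f, [&& f \in N, v \in f & f :&: U == [set v]]].
  by exists f.
have blocked f : f \in N -> v \in f -> exists y, y \in f :&: (U :\ v).
  move=> fN vf; apply/set0Pn/negP => /eqP fU0.
  move: none; rewrite negb_exists => /forallP/(_ f); rewrite fN vf /= => /eqP[].
  by rewrite -[in LHS](setD1K vU) setIUr fU0 setU0; apply/setIidPr; rewrite sub1set.
pose h (f : {set V}) := odflt v [pick y in f :&: (U :\ v)].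
have hP f : f \in N -> v \in f -> h f \in f :&: (U :\ v).
  move=> fN vf; rewrite /h; case: pickP => [y //|no].
  by have [y] := blocked f fN vf; rewrite no.
have inj : {in [set e in N | v \in e] &, injective h}.
  move=> f g; rewrite !inE => /andP[fN vf] /andP[gN vg] hfg.
  apply/eqP/negPn/negP => fg.
  have := hP g gN vg; have := hP f fN vf; rewrite -hfg !inE.
  move=> /and3P[hf hv _] /and3P[hg _ _].
  by move: hv; rewrite (linear_meet_eq Elin (NE _ fN) (NE _ gN) fg hf hg vf vg) eqxx.
have : degree N v <= #|U :\ v|.
  rewrite /degree -(card_in_imset inj); apply: subset_leq_card.
  apply/subsetP => _ /imsetP[f + ->]; rewrite inE => /andP[fN vf].
  by have := hP f fN vf; rewrite inE => /andP[].
by move: hN; rewrite (cardsD1 v U) vU; lia.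
Qed.

(** * Growing linear paths *)

Definition covered (V : finType) (s : seq {set V}) : {set V} :=
  \bigcup_(e <- s) e.

Lemma covered_cons (V : finType) (f : {set V}) s :
  covered (f :: s) = f :|: covered s.
Proof. by rewrite /covered big_cons. Qed.

Lemma sub_covered (V : finType) (s : seq {set V}) e :
  e \in s -> e \subset covered s.
Proof.
elim: s => // g s IHs; rewrite inE covered_cons => /predU1P[->|/IHs es].
  exact: subsetUl.
exact: subset_trans es (subsetUr _ _).
Qed.

Lemma linear_path_rcons (V : finType) (s : seq {set V}) g f :
  linear_path (rcons s g) -> #|g :&: f| = 1 ->
  (forall e, e \in s -> e :&: f = set0) -> linear_path (rcons (rcons s g) f).
Proof.
move=> [L1 L2] gf sf; rewrite size_rcons in L1 L2.
split=> [i|i j]; rewrite !size_rcons => hi.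
  rewrite (nth_rcons _ (rcons s g)) (nth_rcons _ _ _ i.+1) size_rcons.
  rewrite [i < _]hi; have [iS|] := ltnP i (size s); first by rewrite ltnS iS L1.
  move=> si; have -> : i = size s by lia.
  by rewrite nth_rcons !ltnn !eqxx.
move=> hj.
rewrite (nth_rcons _ (rcons s g)) (nth_rcons _ (rcons s g) _ j) size_rcons.
have -> : i < (size s).+1 by lia.
have [jS|sj] := ltnP j (size s).+1; first exact: L2.
have -> : j == (size s).+1 by lia.
have iS : i < size s by lia.
by rewrite nth_rcons iS; apply: sf; rewrite mem_nth.
Qed.

(** The path is listed from its last edge to its first, so that prefixes of the
    path are suffixes of [s] and structural induction truncates it.  The vertex
    [x] is where the path may be continued. *)
Inductive grown (V : finType) (A B : {set {set V}}) :
    seq {set V} -> V -> Prop :=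
| grown_start e x : e \in A -> x \in e -> grown A B [:: e] x
| grown_step f s u x : grown A B s u -> f \in B ->
    f :&: covered s = [set u] -> x \in f -> x != u -> grown A B (f :: s) x.

Section Grown.
Variables (V : finType) (E A B : {set {set V}}).
Hypothesis Elin : linear_hypergraph E.
Hypotheses (AE : A \subset E) (BE : B \subset E).

Lemma grown_end s x : grown A B s x ->
  exists g t, [/\ s = g :: t, x \in g & x \notin covered t].
Proof.
case=> [e y eA ye|f t u y _ fB fU yf yu].
  by exists e, [::]; rewrite /covered big_nil inE.
exists f, t; split=> //; apply: contra yu => yt.
by rewrite -in_set1 -fU inE yf.
Qed.

Lemma grown_end_covered s x : grown A B s x -> x \in covered s.
Proof. by move=> /grown_end[g [t [-> xg _]]]; rewrite covered_cons inE xg. Qed.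

(** If [f] meets the path in the end [y] alone, then each vertex of [f] is an
    end: [y] of the path itself, the others of the path with [f] added. *)
Lemma grown_attach s y f x : grown A B s y -> f \in B ->
  f :&: covered s = [set y] -> x \in f -> exists t, grown A B t x.
Proof.
move=> sy fB fU xf; case: (eqVneq x y) => [->|xy]; first by exists s.
by exists (f :: s); apply: grown_step sy fB fU xf xy.
Qed.

(** Discard the edges of the path after the first one, say [g], that meets [f].
    Then [f] meets what is left in a single vertex of [g], by linearity, which
    is a legitimate end because [f] misses the edges before [g].  Either
    disjointness of [A] and [B] or the choice of [g] ensures [f != g]. *)
Lemma grown_reroute s u f x : [disjoint A & B] -> grown A B s u ->
  f \in B -> f :&: covered s != set0 -> x \in f -> exists t, grown A B t x.
Proof.
move=> AB su fB + xf; have fE := subsetP BE f fB.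
elim: su => [e y eA ye|g t v y tv IHt gB gt yg yv].
  rewrite /covered big_seq1 => /set0Pn[z /setIP[zf ze]].
  have ef : f != e by apply: contraTneq fB => ->; apply/negbT/(disjointFr AB eA).
  apply: (@grown_attach [:: e] z f) => //; first exact: grown_start.
  rewrite /covered big_seq1; apply/setP => w; rewrite !inE.
  apply/andP/eqP => [[wf we]|-> //].
  exact: (linear_meet_eq Elin fE (subsetP AE e eA) ef).
have [ft _|/negPn/eqP ft] := boolP (f :&: covered t != set0); first exact: IHt ft.
rewrite covered_cons setIUr ft setU0 => /set0Pn[z /setIP[zf zg]].
have vgt : v \in g :&: covered t by rewrite gt set11.
have fg : f != g by apply: contraTneq vgt => <-; rewrite ft inE.
have zv : z != v.
  apply: contraTneq vgt => zv; rewrite -zv inE zg /=; apply/negP => zt.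
  by have : z \in f :&: covered t by [rewrite inE zf]; rewrite ft inE.
apply: (@grown_attach (g :: t) z f) => //; first exact: (grown_step tv gB gt zg zv).
rewrite covered_cons setIUr ft setU0; apply/setP => w; rewrite !inE.
apply/andP/eqP => [[wf wg]|-> //].
exact: (linear_meet_eq Elin fE (subsetP BE g gB) fg).
Qed.

Lemma grown_reaches : [disjoint A & B] -> E = A :|: B ->
  connected_hypergraph E -> (exists2 e, e \in A & e != set0) ->
  forall x, exists s, grown A B s x.
Proof.
move=> AB EAB Econn [e eA /set0Pn[y ye]] x.
case/connectP: (Econn y x) => q; have : exists s, grown A B s y.
  by exists [:: e]; apply: grown_start.
elim: q y {ye} => [|z q IHq] y [s sy] /=; first by move=> _ ->; exists s.
case/andP=> /andP[_ /existsP[f /and3P[fE yf zf]]]; apply: IHq.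
move: fE; rewrite EAB inE => /orP[fA|fB].
  by exists [:: f]; apply: grown_start.
apply: (grown_reroute AB sy fB) => //; apply/set0Pn; exists y.
by rewrite inE yf grown_end_covered.
Qed.

Lemma grown_card_covered r s x : uniform E r -> 0 < r -> grown A B s x ->
  #|covered s| <= r.-1 * size s + 1.
Proof.
move=> Er r0; elim=> [e y eA _|f t u y _ IHt fB ft _ _].
  by rewrite /covered big_seq1 (Er _ (subsetP AE e eA)) /=; lia.
have := cardsUI f (covered t).
by rewrite ft cards1 covered_cons (Er _ (subsetP BE f fB)) /=; nia.
Qed.

(** The bound on the degrees beats the at most [r.-1 * (p - 1) + 1] vertices of
    a path that is still shorter than [p]. *)
Lemma grown_extend r p (W : {set V}) s x : uniform E r -> 1 < r ->
  {in W, forall v, r.-1 * (p - 1) + 1 <= degree [set e in B | e \subset W] v} ->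
  grown A B s x -> x \in W -> size s < p ->
  exists f y, grown A B (f :: s) y /\ y \in W.
Proof.
move=> Er r1 Wdeg sx xW sp.
have NE : [set e in B | e \subset W] \subset E.
  by apply: subset_trans BE; apply/subsetP => e; rewrite inE => /andP[].
have cs : #|covered s| <= degree [set e in B | e \subset W] x.
  apply: leq_trans (Wdeg x xW).
  by have := grown_card_covered Er (ltnW r1) sx; nia.
have [f [fN xf fU]] := escaping_edge Elin NE (grown_end_covered sx) cs.
move: fN; rewrite inE => /andP[fB /subsetP fW].
have /card_gt0P[y] : 0 < #|f :\ x|.
  by move: r1; rewrite -(Er f (subsetP BE f fB)) (cardsD1 x) xf.
rewrite !inE => /andP[yx yf]; exists f, y; split; last exact: fW.
exact: grown_step sx fB fU yf yx.
Qed.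

Lemma grown_long r p (W : {set V}) s x : uniform E r -> 1 < r ->
  {in W, forall v, r.-1 * (p - 1) + 1 <= degree [set e in B | e \subset W] v} ->
  grown A B s x -> x \in W -> exists t y, grown A B t y /\ p <= size t.
Proof.
move=> Er r1 Wdeg; have [n] := ubnP (p - size s).
elim: n s x => // n IHn s x sn sx xW.
have [ps|sp] := leqP p (size s); first by exists s, x.
have [f [y [fsy yW]]] := grown_extend Er r1 Wdeg sx xW sp.
by apply: IHn fsy yW => /=; lia.
Qed.

Lemma grown_linear_path s x : grown A B s x -> linear_path (rev s).
Proof.
elim=> [e y _ _|f s' u y s'u IH _ fU _ _].
  by split=> [[|i]|i [|j]] //=; rewrite ltnS ltn0.
have [g [t [Es ug ut]]] := grown_end s'u; move: IH fU; rewrite Es.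
rewrite !rev_cons covered_cons => IH fU; apply: linear_path_rcons => //.
  rewrite setIC -(cards1 u) -fU setIUr; congr #|pred_of_set _|.
  apply/esym/setUidPl/subsetP => w /setIP[wf wt].
  have : w \in f :&: (g :|: covered t) by rewrite !inE wf wt orbT.
  by rewrite fU inE => /eqP wu; rewrite -wu wt in ut.
move=> e; rewrite mem_rev => /sub_covered/subsetP et; apply/setP => w.
rewrite !inE; apply/negP => /andP[/et wt wf].
have : w \in f :&: (g :|: covered t) by rewrite !inE wf wt orbT.
by rewrite fU inE => /eqP wu; rewrite -wu wt in ut.
Qed.

Lemma grown_colors s x : grown A B s x ->
  exists e t, [/\ rev s = e :: t, e \in A & {subset t <= B}].
Proof.
elim=> [e y eA _|f s' u y _ [e [t [Es eA tB]]] fB _ _ _]; first by exists e, [::].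
exists e, (rcons t f); rewrite rev_cons Es; split=> // g.
by rewrite mem_rcons inE => /predU1P[->|/tB].
Qed.

End Grown.

(** * The theorem *)

Lemma avg_degree_ge (V : finType) (F : {set {set V}}) (r k : nat) :
  uniform F r -> 0 < r -> 0 < #|V| ->
  ((r * k)%N%:R <= avg_degree F)%R -> k * #|V| <= #|F|.
Proof.
move=> Fr r0 V0; rewrite (avg_degree_uniform Fr).
rewrite Num.Theory.ler_pdivlMr ?Num.Theory.ltr0n //.
by rewrite -GRing.natrM Num.Theory.ler_nat -mulnA leq_pmul2l.
Qed.

Theorem lemma2p7 (r p : nat) (hr : 2 <= r) (hp : 2 <= p)
    (V : finType) (E : {set {set V}}) (c : {set V} -> nat)
    (Econn : connected_hypergraph E)
    (Elin : linear_hypergraph E)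
    (Eunif : uniform E r)
    (hc : forall e, e \in E -> c e = 1 \/ c e = 2)
    (hc1 : exists e, e \in color_class E c 1)
    (hc2 : exists e, e \in color_class E c 2)
    (hd : ((r * (r - 1) * (p - 1) + 2 * r)%N%:R
             <= avg_degree (color_class E c 1))%R) :
  exists (e : {set V}) (s : seq {set V}),
    [/\ {subset e :: s <= E},
        linear_path (e :: s),
        p <= size (e :: s),
        c e = 2
      & forall f, f \in s -> c f = 1].
Proof.
set A := color_class E c 2; set B := color_class E c 1 in hd.
have AE : A \subset E by apply/subsetP => e; rewrite inE => /andP[].
have BE : B \subset E by apply/subsetP => e; rewrite inE => /andP[].
have AB : [disjoint A & B].
  apply/pred0P => e; rewrite !inE.
  by apply/negP => /andP[/andP[_ /eqP->] /andP[]].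
have EAB : E = A :|: B.
  apply/setP => e; rewrite !inE; have [eE|//] := boolP (e \in E).
  by case: (hc e eE) => ->.
have edge_gt0 e : e \in E -> 0 < #|e| by move=> eE; rewrite Eunif // ltnW.
have B0 : set0 \notin B by apply/negP => /(subsetP BE)/edge_gt0; rewrite cards0.
have [e2 e2A] := hc2.
have e2_gt0 := edge_gt0 e2 (subsetP AE e2 e2A).
have V0 : 0 < #|V| := leq_trans e2_gt0 (max_card _).
have Bunif : uniform B r by move=> e /(subsetP BE)/Eunif.
have dens : (r.-1 * (p - 1) + 2) * #|V| <= #|B|.
  apply: (avg_degree_ge Bunif (ltnW hr) V0).
  by rewrite mulnDr mulnA -subn1 [r * 2]mulnC.
have [W /set0Pn[w wW] Wdeg] := dense_core B0 V0 dens.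
have [s sw] : exists s, grown A B s w.
  apply: (grown_reaches Elin AE BE AB EAB Econn).
  by exists e2 => //; rewrite -card_gt0.
have Wdeg1 : {in W, forall v,
    r.-1 * (p - 1) + 1 <= degree [set e in B | e \subset W] v}.
  by move=> v /Wdeg; lia.
have [t [y [ty pt]]] := grown_long Elin AE BE Eunif hr Wdeg1 sw wW.
have [e [q [Et eA qB]]] := grown_colors ty.
exists e, q; rewrite -Et; split.
- move=> f; rewrite Et inE => /predU1P[->|/qB/(subsetP BE)//].
  exact: (subsetP AE).
- exact: grown_linear_path ty.
- by rewrite size_rev.
- by move: eA; rewrite inE => /andP[_ /eqP].
- by move=> f /qB; rewrite inE => /andP[_ /eqP].
Qed.
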